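(* Let $R\geq 4$, let $q'$ be a prime power, $q=(q')^{R}$, and fix $\gamma\in\{2,3,\ldots,R-1\}$. Put $$n^{(\gamma)}_{R,q}=\frac{\sum_{i=1}^{\gamma+1}(\sqrt[R]{q}-1)^{i}\binom{R+\gamma}{i}}{\sqrt[R]{q}-1}\qquad\Bigl(\text{so } n^{(\gamma)}_{R,q}\sim\tbinom{R+\gamma}{R-1}q^{\gamma/R}\text{ as } q\to\infty\Bigr),$$ and let $t_0$ be an integer with $q^{t_0-1}\geq n^{(\gamma)}_{R,q}$. Then for every codimension $r=Rt+\gamma$ with $t=1$ or $t\geq t_0$ there exists a linear $[n,n-r]_q$ code with covering radius $R$ and length $$n=n^{(\gamma)}_{R,q}\cdot q^{\frac{r-(R+\gamma)}{R}}+w\,\frac{q^{\frac{r-(R+\gamma)}{R}}-1}{q-1}\quad\text{for some integer } 0\leq w\leq R-3.$$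
   Context: For a prime power $q$, an $[n,n-r]_q$ code is a linear subspace of $F_q^n$ of dimension $n-r$. It has covering radius $R$ if every column of $F_q^{r}$ is a linear combination of at most $R$ columns of a parity-check matrix of the code, and $R$ is the smallest integer with this property. *)

(* Defs.v *)
From HB Require Import structures.
From mathcomp Require Import all_boot all_order all_algebra.
From mathcomp Require Import all_classical all_reals all_analysis.

Set Implicit Arguments.
Unset Strict Implicit.
Unset Printing Implicit Defensive.

Import Order.TTheory GRing.Theory Num.Theory.

Local Open Scope ring_scope.

Definition prime_power (m : nat) : Prop :=
  exists p k : nat, [/\ prime p, (0 < k)%N & m = (p ^ k)%N].

Definition is_parity_check (F : finFieldType) (r n : nat)
    (H : 'M[F]_(r, n)) (C : {vspace 'rV[F]_n}) : Prop :=
  \rank H = r /\ forall x : 'rV[F]_n, x \in C <-> H *m x^T = 0.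

Definition columns_cover (F : finFieldType) (r n : nat)
    (H : 'M[F]_(r, n)) (rho : nat) : Prop :=
  forall s : 'cV[F]_r, exists (J : {set 'I_n}) (c : 'I_n -> F),
    (#|J| <= rho)%N /\ s = \sum_(j in J) c j *: col j H.

(* The choice of the parity-check matrix H is immaterial: two such matrices
   differ by an invertible left factor. *)
Definition has_covering_radius (F : finFieldType) (r n : nat)
    (C : {vspace 'rV[F]_n}) (rho : nat) : Prop :=
  exists H : 'M[F]_(r, n),
    [/\ is_parity_check H C,
        columns_cover H rho
      & forall k : nat, columns_cover H k -> (rho <= k)%N].

(* m stands for the R-th root of the field order q = m ^ R. *)
Definition nRq (K : realType) (R gamma m : nat) : K :=
  (\sum_(1 <= i < gamma.+2) (m%:R - 1) ^+ i * 'C(R + gamma, i)%:R)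
    / (m%:R - 1).

(* Main.v *)
(** Let K0 be the subfield of order q' of F.  The columns of the base
    parity-check matrix are the points of PG(R + gamma - 1, q') of weight at most
    gamma + 1.  A vector x over F lies in the F-span of an at most R-dimensional
    space over K0, and a reduced echelon basis of such a space consists of
    vectors of weight at most gamma + 1, so R columns suffice; a vector whose
    entries are a K0-basis of F requires R of them.

    One can moreover always use R distinct columns with nonzero coefficients.
    Hence, when the number of columns h_j is at most |L| for the field extension
    L of F of degree t - 1, distinct elements beta_j of L can be attached to
    them, and the columns (h_j, xi, beta_j xi, ..., beta_j^(R-1) xi), xi in L,
    have covering radius R again by a Vandermonde argument.  This realizes the
    length of the theorem with w = 0. *)

Require Import Defs.
From HB Require Import structures.
From mathcomp Require Import all_boot all_order all_fingroup all_algebra.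
From mathcomp Require Import all_solvable all_field.
From mathcomp Require Import boolp zify lra.

Set Implicit Arguments.
Unset Strict Implicit.
Unset Printing Implicit Defensive.

Import Order.TTheory GRing.Theory Num.Theory.

Local Open Scope ring_scope.


(** * Finite fields: fixed points of Frobenius and extensions of given degree *)

Lemma prim_root_finField (F : finFieldType) :
  exists z : F, (#|F|.-1).-primitive_root z.
Proof.
have q1 : (0 < #|F|.-1)%N by rewrite -subn1 subn_gt0 finNzRing_gt1.
suff /hasP[z _ zP] : has (#|F|.-1).-primitive_root (enum (predC1 (0 : F))).
  by exists z.
apply: has_prim_root => //.
- apply/allP=> x; rewrite mem_enum !inE => x0; rewrite unity_rootE.
  by rewrite -(inj_eq (mulfI x0)) -exprS prednK ?expf_card ?mulr1 // ltnW ?finNzRing_gt1.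
- exact: enum_uniq.
- by rewrite -cardE cardC1.
Qed.

(** Above, ['X^m - 'X] has at most [m] roots. Below, [m - 1] divides [m ^ e - 1], so some [y] has
    order [m - 1], and 0 together with the powers of [y] gives [m] fixed points. *)
Lemma card_frobenius_fixed (F : finFieldType) (m e : nat) :
  (1 < m)%N -> #|F| = (m ^ e)%N -> #|[pred x : F | x ^+ m == x]| = m.
Proof.
move=> m1 cF; have m0 := ltnW m1.
have m1p : (0 < m.-1)%N by rewrite -subn1 subn_gt0.
apply/eqP; rewrite eqn_leq; apply/andP; split.
  have s : size ('X^m - 'X : {poly F}) = m.+1.
    by rewrite size_polyDl size_polyXn // size_polyN size_polyX.
  rewrite -ltnS -s cardE; apply: max_poly_roots; last exact: enum_uniq.
    by rewrite -size_poly_gt0 s.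
  by apply/allP=> x; rewrite mem_enum inE /root !hornerE subr_eq0.
have [z zP] := prim_root_finField F.
have dvd : (m.-1 %| #|F|.-1)%N by rewrite cF dvdn_pred_predX.
have yP := dvdn_prim_root zP dvd; set y := z ^+ _ in yP.
pose f (i : 'I_m) : F := if val i == 0%N then 0 else y ^+ i.
have y0 : y != 0 by rewrite -unitfE -(unitrX_pos _ m1p) (prim_expr_order yP) unitr1.
have finj : injective f.
  move=> i j; rewrite /f.
  case: (val i =P 0%N) => [i0|/eqP i0]; case: (val j =P 0%N) => [j0|/eqP j0].
  - by move=> _; apply/val_inj; rewrite /= i0 j0.
  - by move/eqP; rewrite eq_sym expf_eq0 (negPf y0) andbF.
  - by move/eqP; rewrite expf_eq0 (negPf y0) andbF.
  have lt (k : 'I_m) : val k != 0%N -> ((val k).-1 < m.-1)%N.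
    by case: k => -[|k] //= km _; rewrite -ltnS prednK.
  move/eqP; rewrite -(prednK (_ : 0 < i)%N) ?lt0n // -(prednK (_ : 0 < j)%N) ?lt0n //.
  rewrite !exprS (inj_eq (mulfI y0)) (eq_prim_root_expr yP) => /eqP.
  rewrite !modn_small ?lt // => ij; apply/val_inj.
  by move: ij i0 j0 => /=; case: (nat_of_ord i) (nat_of_ord j) => [|a] [|b] //= ->.
rewrite -[X in (X <= _)%N]card_ord -(card_imset _ finj) subset_leq_card //.
apply/subsetP=> _ /imsetP[i _ ->]; rewrite inE /f.
case: (val i == 0%N); first by rewrite expr0n gtn_eqF.
by rewrite exprAC -{1}(prednK m0) exprS (prim_expr_order yP) mulr1.
Qed.

Lemma card_finvect_type (F : finFieldType) (V : vectType F) :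
  #|finvect_type V| = (#|F| ^ \dim {:V})%N.
Proof.
pose cV := Vector.class (finvect_type V).
by rewrite -(@card_vspacef F _ cV) (@card_vspace F _ cV).
Qed.

(** The splitting field of ['X^Q - 'X] with [Q = #|F| ^ m] consists exactly of the [Q] distinct
    roots; counting then gives the degree. *)
Lemma finField_extension (F : finFieldType) (m : nat) :
  (0 < m)%N -> exists L : fieldExtType F, \dim {:L} = m.
Proof.
move=> m0; pose Q := (#|F| ^ m)%N.
have F1 := finNzRing_gt1 F.
have Q1 : (1 < Q)%N by rewrite -(expn0 #|F|) ltn_exp2l.
have s (A : nzRingType) : size ('X^Q - 'X : {poly A}) = Q.+1.
  by rewrite size_polyDl size_polyXn // size_polyN size_polyX.
have /FinSplittingFieldFor[/= L] : 'X^Q - 'X != 0 :> {poly F}.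
  by rewrite -size_poly_gt0 s.
rewrite rmorphB rmorphXn /= map_polyX => -[zs Dzs defL]; exists L.
have Q0 : Q%:R = 0 :> L.
  rewrite natrX -(rmorph_nat (in_alg L)) -cardsT.
  have -> : #|[set: F]|%:R = 0 :> F.
    by rewrite -FinRing.zmodXgE expg_cardG ?inE.
  by rewrite rmorph0 expr0n gtn_eqF.
(* As [Q] vanishes in [L], the derivative of ['X^Q - 'X] is -1, so the roots are simple. *)
have Uzs : uniq zs.
  rewrite -separable_prod_XsubC -(eqp_separable Dzs) separable_poly.unlock.
  rewrite derivB derivXn derivX -mulr_natl -polyC_natr Q0 mul0r sub0r.
  rewrite -(scaleN1r 1) coprimepZr ?oppr_eq0 ?oner_eq0 //.
  exact: coprimep1.
have /finField_galois_generator[/= a _ Da] : (1 <= {:L})%VS by apply: sub1v.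
pose E := fixedSpace (a ^+ m)%g; rewrite dimv1 expn1 in Da.
have aQ x : (a ^+ m)%g x = x ^+ Q.
  rewrite /Q; elim: (m) => [|n IHn]; first by rewrite gal_id.
  by rewrite expgSr expnSr exprM -IHn galM ?Da ?memvf.
have zsE x : (x \in zs) = (x ^+ Q == x).
  by rewrite -root_prod_XsubC -(eqp_root Dzs) /root !hornerE subr_eq0.
(* The fixed space of [a ^+ m] is a subfield containing all the roots, and these generate [L]. *)
have EL : E = {:L}%VS.
  apply/eqP; rewrite eqEsubv subvf -defL -[E]subfield_closed agenvS //.
  rewrite subv_add sub1v; apply/span_subvP=> z; rewrite zsE => /eqP zQ.
  by apply/fixedSpaceP; rewrite aQ.
have zs_all x : x \in zs.
  by rewrite zsE -aQ; apply/eqP/fixedSpaceP; rewrite -/E EL memvf.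
pose Lf := finvect_type L.
have cL : #|Lf| = Q.
  have -> : #|Lf| = size (zs : seq Lf).
    have /card_uniqP <- : uniq (zs : seq Lf) by exact: Uzs.
    by apply: eq_card => x; rewrite [RHS]zs_all.
  by apply: succn_inj; rewrite -(size_prod_XsubC _ id) -(eqp_size Dzs) s.
by apply/eqP; rewrite -(eqn_exp2l _ _ F1) -card_finvect_type cL.
Qed.

(** * From families of columns to codes with a given covering radius *)

Definition covers_exactly (F : fieldType) (V : lmodType F) (I : finType)
    (h : I -> V) (rho : nat) : Prop :=
  forall v, exists (J : {set I}) (c : I -> F),
    [/\ #|J| = rho, {in J, forall j, c j != 0} & v = \sum_(j in J) c j *: h j].

(** Indexing through [g] lets a column occur several times, so the bound survives when distinct
    columns have equal projections, as in [concat_needs_columns]. *)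
Definition needs_columns (F : fieldType) (V : lmodType F) (I : finType)
    (h : I -> V) (rho : nat) (v : V) : Prop :=
  forall (T : finType) (A : {set T}) (g : T -> I) (c : T -> F),
    v = \sum_(t in A) c t *: h (g t) -> (rho <= #|A|)%N.


(** The code is the kernel of the matrix of coordinate columns. Covering makes this matrix of full
    rank, which yields the dimension, and [v0] rules out a smaller radius. *)
Lemma code_of_columns (F : finFieldType) (V : vectType F) (I : finType)
    (h : I -> V) (rho r n : nat) (v0 : V) :
  \dim {:V} = r -> #|I| = n ->
  (forall v, exists (J : {set I}) (c : I -> F),
     (#|J| <= rho)%N /\ v = \sum_(j in J) c j *: h j) ->
  needs_columns h rho v0 ->
  exists C : {vspace 'rV[F]_n},
    [/\ (r <= n)%N, \dim C = (n - r)%N & has_covering_radius r C rho].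
Proof.
move=> <- <- cov v0P; set r' := \dim {:V}.
pose b := vbasis {:V}.
pose co (v : V) : 'cV[F]_r' := \col_i coord b i v.
have coK v : \sum_i co v i 0 *: b`_i = v.
  rewrite [RHS](coord_vbasis (memvf v)).
  by apply: eq_bigr => i _; rewrite mxE.
have coS (T : finType) (A : {set T}) (c : T -> F) (g : T -> V) :
    co (\sum_(t in A) c t *: g t) = \sum_(t in A) c t *: co (g t).
  apply/colP=> i; rewrite mxE linear_sum summxE.
  by apply: eq_bigr => t _; rewrite !mxE linearZ.
have coI : injective co by move=> u v e; rewrite -(coK u) e coK.
have coKV (s : 'cV[F]_r') : co (\sum_i s i 0 *: b`_i) = s.
  apply/colP=> i; rewrite mxE coord_sum_free //.
  exact: basis_free (vbasisP _).
pose H : 'M[F]_(r', #|I|) := \matrix_(i, j) co (h (enum_val j)) i 0.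
have colH j : col j H = co (h (enum_val j)).
  by apply/colP=> i; rewrite !mxE.
have covH : columns_cover H rho.
  move=> s; have [J [c [Jr sE]]] := cov (\sum_i s i 0 *: b`_i).
  exists (enum_rank @: J), (fun j => c (enum_val j)); split.
    by rewrite card_imset //; exact: enum_rank_inj.
  rewrite -(coKV s) sE coS big_imset /=; last by move=> ? ? _ _; apply: enum_rank_inj.
  by apply: eq_bigr => j _; rewrite colH enum_rankK.
pose f := linfun (mulmxr H^T : 'rV[F]_#|I| -> 'rV[F]_r').

have fE x : f x = x *m H^T by rewrite lfunE.
have f_full : limg f = fullv.
  apply/vspaceP=> y; rewrite memvf.
  have [J [c [_ yE]]] := covH y^T.
  apply/memv_imgP; exists (\row_j if j \in J then c j else 0); rewrite ?memvf //.
  apply: trmx_inj; rewrite fE trmx_mul trmxK yE.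
  apply/colP=> i; rewrite summxE !mxE big_mkcond; apply: eq_bigr => j _.
  by rewrite !mxE; case: ifP => _; rewrite ?mulr0 // mulrC.
have rkH : \rank H = r'.
  rewrite -mxrank_tr; apply/eqP; rewrite -/(row_full _) -sub1mx.
  apply/row_subP=> i; apply/submxP.
  have : row i 1%:M \in limg f by rewrite f_full memvf.
  by case/memv_imgP=> x _ ->; exists x; rewrite fE.
exists (lker f); split.
- by rewrite -rkH rank_leq_col.
- have := limg_ker_dim f fullv; rewrite capfv f_full !dimvf /= /dim /= !mul1n.
  by move=> e; rewrite -[X in (X - _)%N]e addnK.
exists H; split=> //.
  split=> // x; rewrite memv_ker fE; split=> [/eqP e|e].
    by apply: trmx_inj; rewrite trmx_mul trmxK e !trmx0.
  by apply/eqP; apply: trmx_inj; rewrite trmx_mul trmxK e !trmx0.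
move=> k covk; have [J [c [Jk e]]] := covk (co v0).
apply: leq_trans Jk; apply: (v0P _ J enum_val c); apply: coI.
by rewrite e coS; apply: eq_bigr => j _; rewrite colH.
Qed.

(** * Lengthening by a Vandermonde construction *)

Lemma vandermonde_solve (L : fieldType) (I : finType) (J : {set I})
    (beta : I -> L) (U : 'I_#|J| -> L) :
  injective beta ->
  exists eta : I -> L,
    forall i : 'I_#|J|, \sum_(j in J) eta j * beta j ^+ i = U i.
Proof.
move=> beta_inj; pose a : 'rV[L]_#|J| := \row_k beta (enum_val k).
pose V := Vandermonde #|J| a.
have Vu : V \in unitmx.
  rewrite unitmxE det_Vandermonde unitfE; apply/prodf_neq0 => i _.
  apply/prodf_neq0 => j ij; rewrite !mxE subr_eq0 (inj_eq beta_inj).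
  by rewrite (inj_eq enum_val_inj); apply: contraTneq ij => ->; rewrite ltnn.
pose x := invmx V *m \col_i U i.
(* The sum has a single term for [j] in [J] and is empty otherwise; it reindexes the solution [x] by
   [I]. *)
exists (fun j => \sum_(k | enum_val k == j) x k 0) => i.
transitivity ((V *m x) i 0); last by rewrite mulKVmx // mxE.
rewrite mxE big_enum_val; apply: eq_bigr => k _.
rewrite (big_pred1 k) => [|l]; last by rewrite (inj_eq enum_val_inj).
by rewrite !mxE mulrC.
Qed.

(* [finvect_type L] is [L] itself with its finite-type structure. *)
Definition concat_column (F : finFieldType) (V : vectType F) (I : finType)
    (h : I -> V) (rho : nat) (L : fieldExtType F) (beta : I -> L)
    (p : I * finvect_type L) : V * {ffun 'I_rho -> L} :=
  (h p.1, [ffun i : 'I_rho => beta p.1 ^+ i * p.2]).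

Lemma dim_concat (F : fieldType) (V L : vectType F) (rho : nat) :
  \dim {:(V * {ffun 'I_rho -> L})%type} = (\dim {:V} + rho * \dim {:L})%N.
Proof. by rewrite !dimvf -[in RHS](card_ord rho). Qed.

Lemma concat_covers (F : finFieldType) (V : vectType F) (I : finType)
    (h : I -> V) (rho : nat) (L : fieldExtType F) (beta : I -> L) :
  injective beta -> covers_exactly h rho ->
  forall w, exists (J : {set I * finvect_type L}) (c : I * finvect_type L -> F),
    (#|J| <= rho)%N /\ w = \sum_(p in J) c p *: concat_column h rho beta p.
Proof.
move=> beta_inj cov [v U]; have [J [c [Jr c0 vE]]] := cov v.
(* With [rho] replaced by [#|J|], there are as many equations as unknowns. *)
rewrite -Jr in U *.
have [eta etaE] := vandermonde_solve U beta_inj.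
(* Dividing by [c j] cancels the coefficient already imposed by the representation of [v]. *)
pose xi j : I * finvect_type L := (j, (c j)^-1 *: eta j).
exists (xi @: J), (fun p => c p.1); split; first exact: leq_imset_card.
rewrite big_imset /=; last by move=> i j _ _ [].
apply: injective_projections => /=.
  by rewrite vE (raddf_sum fst).
rewrite (raddf_sum snd); apply/ffunP=> i; rewrite sum_ffunE -etaE.
apply: eq_bigr => j jJ; rewrite !ffunE.
by rewrite -scalerAr scalerA mulfV ?c0 // scale1r mulrC.
Qed.

Lemma concat_needs_columns (F : finFieldType) (V : vectType F) (I : finType)
    (h : I -> V) (rho : nat) (L : fieldExtType F) (beta : I -> L) (v : V) :
  needs_columns h rho v ->
  needs_columns (concat_column h rho beta) rho (v, 0).
Proof.
move=> vP T A g c vE; apply: (vP T A (fun t => (g t).1) c).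
by have := congr1 fst vE; rewrite (raddf_sum fst).
Qed.

(** * Linear algebra over a subfield *)

Lemma exists_set_between (T : finType) (A B : {set T}) (n : nat) :
  A \subset B -> (#|A| <= n <= #|B|)%N ->
  exists C : {set T}, [/\ A \subset C, C \subset B & #|C| = n].
Proof.
move=> AB /andP[An nB].
have : (0 < #|[set D : {set T} | (D \subset B :\: A) && (#|D| == n - #|A|)]|)%N.
  by rewrite cards_draws bin_gt0 cardsDS // leq_sub2r.
case/card_gt0P=> D; rewrite inE subsetD => /andP[/andP[DB DA] /eqP Dn].
exists (A :|: D); split; first exact: subsetUl.
  by rewrite subUset AB.
by rewrite cardsU Dn disjoint_setI0 1?disjoint_sym // cards0 subn0 subnKC.
Qed.

(** [K0] is a subset of [F] and not a type of scalars, so dimension over [K0] is handled by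
    counting: [card_le_span] and [card_independent] compare powers of [#|K0|] with [#|F|]. *)
Definition in_span (F : fieldType) (K0 : divringClosed F) (T : finType)
    (A : {set T}) (x : T -> F) (y : F) : Prop :=
  exists2 a : T -> F, forall t, a t \in K0 & y = \sum_(t in A) a t * x t.

Definition independent (F : fieldType) (K0 : divringClosed F) (T : finType)
    (A : {set T}) (x : T -> F) : Prop :=
  forall a : T -> F, (forall t, a t \in K0) ->
    \sum_(t in A) a t * x t = 0 -> {in A, forall t, a t = 0}.

Lemma in_span_subset (F : fieldType) (K0 : divringClosed F) (T : finType)
    (A B : {set T}) (x : T -> F) (y : F) :
  A \subset B -> in_span K0 A x y -> in_span K0 B x y.
Proof.
move=> AB [a aK ->]; exists (fun t => if t \in A then a t else 0).
  by move=> t; case: ifP => _; rewrite ?rpred0.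
rewrite big_mkcond [RHS]big_mkcond; apply: eq_bigr => t _.
case: ifP => tA; first by rewrite (subsetP AB).
by rewrite mul0r if_same.
Qed.

Lemma card_le_span (F : finFieldType) (K0 : divringClosed F) (T : finType)
    (A : {set T}) (x : T -> F) :
  (forall y, in_span K0 A x y) -> (#|F| <= #|K0| ^ #|A|)%N.
Proof.
move=> spanA; rewrite -(card_pffun_on 0 A K0).
pose f (a : {ffun T -> F}) := \sum_(t in A) a t * x t.
apply: leq_trans (leq_image_card f _); apply: subset_leq_card.
apply/subsetP=> y _; have [a aK ->] := spanA y.
apply/imageP; exists [ffun t => if t \in A then a t else 0].
  apply/pffun_onP; split=> [|_ /imageP[t tA ->]]; last by rewrite ffunE tA.
  by apply/supportP=> t /negPf tA; rewrite ffunE tA.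
by apply: eq_bigr => t tA; rewrite ffunE tA.
Qed.

Lemma card_independent (F : finFieldType) (K0 : divringClosed F) (T : finType)
    (A : {set T}) (x : T -> F) :
  independent K0 A x -> (#|K0| ^ #|A| <= #|F|)%N.
Proof.
move=> indA; rewrite -(card_pffun_on 0 A K0).
pose f (a : {ffun T -> F}) := \sum_(t in A) a t * x t.
rewrite -(@card_in_image _ _ f); first exact: max_card.
move=> a b /pffun_onP[/supportP a0 aK] /pffun_onP[/supportP b0 bK] fab.
have aK' t : a t \in K0.
  by case: (boolP (t \in A)) => tA; [apply/aK/image_f | rewrite a0 ?rpred0].
have bK' t : b t \in K0.
  by case: (boolP (t \in A)) => tA; [apply/bK/image_f | rewrite b0 ?rpred0].
apply/ffunP=> t; case: (boolP (t \in A)) => tA; last by rewrite a0 ?b0.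
apply/eqP; rewrite -subr_eq0; apply/eqP.
apply: (indA (fun t => a t - b t)) tA => [s|]; first by rewrite rpredB.
under eq_bigr do rewrite mulrBl.
by rewrite sumrB; apply/eqP; rewrite subr_eq0; apply/eqP.
Qed.

(** A maximal independent subset works: if [x s] lay outside its span, every relation on the set
    enlarged by [s] would have coefficient 0 at [s], against maximality. *)
Lemma exists_basis (F : fieldType) (K0 : divringClosed F) (T : finType)
    (B : {set T}) (x : T -> F) :
  exists A : {set T}, [/\ A \subset B, independent K0 A x
    & {in B, forall t, in_span K0 A x (x t)}].
Proof.
pose P (A : {set T}) := (A \subset B) && `[< independent K0 A x >].
have P0 : P set0.
  by rewrite /P sub0set; apply/asboolP => a _ _ t; rewrite inE.
have [|A /maxsetP[/andP[AB /asboolP indA] maxA]] := @ex_maxset _ P.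
  by exists set0.
exists A; split=> // s sB; case: (boolP (s \in A)) => sA.
  exists (fun t => (t == s)%:R) => [t|]; first by rewrite rpred_nat.
  rewrite (bigD1 s) //= eqxx mul1r big1 ?addr0 // => t /andP[_ /negPf->].
  by rewrite mul0r.
apply: contrapT => sNspan; move: (sA); rewrite -(maxA (s |: A)) ?setU11 //.
  rewrite /P subUset sub1set sB AB /=; apply/asboolP => a aK.
  rewrite big_setU1 //= => asum.
  have as0 : a s = 0.
    apply: contra_notP sNspan => /eqP as0; exists (fun t => - ((a s)^-1 * a t)).
      by move=> t; rewrite rpredN rpredM ?rpredV.
    apply: (mulfI as0); rewrite -[LHS]opprK (addr0_eq asum) mulr_sumr -sumrN.
    apply: eq_bigr => t _.
    by rewrite mulNr mulrN -mulrA mulVKf.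
  move: asum; rewrite as0 mul0r add0r => asum t /setU1P[->//|].
  exact: indA.
exact: subsetUr.
Qed.

(** * Projective points of low weight and their number *)

Definition supp (F : fieldType) (N : nat) (h : {ffun 'I_N -> F}) : {set 'I_N} :=
  [set i | h i != 0].

Definition light (F : finFieldType) (K0 : divringClosed F) (N w : nat) :
    {set {ffun 'I_N -> F}} :=
  [set h : {ffun 'I_N -> F} | [forall i, h i \in K0] && (0 < #|supp h| <= w)%N].

(* A chosen nonzero entry of [h], or [0] if [h] vanishes; the choice depends on
   the support only. *)
Definition lead (F : fieldType) (N : nat) (h : {ffun 'I_N -> F}) : F :=
  if [pick i in supp h] is Some i then h i else 0.

Definition scal (F : fieldType) (N : nat) (a : F) (h : {ffun 'I_N -> F}) :
    {ffun 'I_N -> F} := [ffun i => a * h i].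

(* One representative of each projective point over [K0] of weight at most w. *)
Definition points (F : finFieldType) (K0 : divringClosed F) (N w : nat) :
    {set {ffun 'I_N -> F}} :=
  [set h in light K0 N w | lead h == 1].

Definition point_column (F : finFieldType) (K0 : divringClosed F) (N w : nat)
    (j : {h | h \in points K0 N w}) : 'rV[F]_N := \row_i val j i.

Lemma supp_scal (F : fieldType) (N : nat) (a : F) (h : {ffun 'I_N -> F}) :
  a != 0 -> supp (scal a h) = supp h.
Proof. by move=> a0; apply/setP=> i; rewrite !inE ffunE mulf_eq0 (negPf a0). Qed.

Lemma lead_scal (F : fieldType) (N : nat) (a : F) (h : {ffun 'I_N -> F}) :
  a != 0 -> lead (scal a h) = a * lead h.
Proof.
move=> a0; rewrite /lead supp_scal //.
by case: pickP => [i _|_]; rewrite ?ffunE ?mulr0.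
Qed.

Lemma lead_in (F : finFieldType) (K0 : divringClosed F) (N w : nat)
    (h : {ffun 'I_N -> F}) :
  h \in light K0 N w -> lead h \in K0 /\ lead h != 0.
Proof.
rewrite inE => /andP[/forallP hK /andP[]]; rewrite /lead.
case: pickP => [i|s0]; first by rewrite inE.
by rewrite (eq_card0 s0).
Qed.

Lemma scal_light (F : finFieldType) (K0 : divringClosed F) (N w : nat) (a : F)
    (h : {ffun 'I_N -> F}) :
  a \in K0 -> a != 0 -> h \in light K0 N w -> scal a h \in light K0 N w.
Proof.
move=> aK a0; rewrite !inE supp_scal // => /andP[/forallP hK ->].
by rewrite andbT; apply/forallP=> i; rewrite ffunE rpredM.
Qed.

Lemma scal_lead_points (F : finFieldType) (K0 : divringClosed F) (N w : nat)
    (h : {ffun 'I_N -> F}) :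
  h \in light K0 N w -> scal (lead h)^-1 h \in points K0 N w.
Proof.
move=> hl; have [lK l0] := lead_in hl.
by rewrite inE scal_light ?rpredV ?invr_eq0 //= lead_scal ?invr_eq0 // mulVf.
Qed.

(** Vectors are sorted by support, each support [S] carrying [#|K0|.-1 ^ #|S|] of them, and supports
    are then sorted by size. *)
Lemma card_light (F : finFieldType) (K0 : divringClosed F) (N w : nat) :
  #|light K0 N w| = (\sum_(1 <= i < w.+1) 'C(N, i) * #|K0|.-1 ^ i)%N.
Proof.
have fiber (S : {set 'I_N}) :
    #|[set h : {ffun 'I_N -> F} | [forall i, h i \in K0] & supp h == S]|
    = (#|K0|.-1 ^ #|S|)%N.
  have -> : #|K0|.-1 = #|[predD1 K0 & (0 : F)]|.
    by rewrite (cardD1 0) rpred0.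
  rewrite -(card_pffun_on 0 S [predD1 K0 & (0 : F)]); apply: eq_card => h.
  rewrite inE; apply/andP/pffun_onP.
    move=> [/forallP hK /eqP<-]; split; last first.
      by move=> _ /imageP[i iS ->]; move: iS; rewrite !inE hK andbT.
    by apply/supportP=> i; rewrite inE negbK => /eqP.
  case=> /supportP h0 hK; split.
    apply/forallP=> i; case: (boolP (i \in S)) => iS; last by rewrite h0 ?rpred0.
    by have := hK _ (image_f h iS); rewrite inE => /andP[].
  apply/eqP/setP=> i; rewrite inE; case: (boolP (i \in S)) => iS.
    by have := hK _ (image_f h iS); rewrite inE => /andP[].
  by rewrite h0 ?eqxx.
rewrite -sum1_card (partition_big (@supp F N) (fun S => 0 < #|S| <= w)%N) /=;
  last by move=> h; rewrite inE => /andP[].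
transitivity (\sum_(S : {set 'I_N} | 0 < #|S| <= w) #|K0|.-1 ^ #|S|)%N.
  apply: eq_bigr => S Sw; rewrite -fiber -sum1_card; apply: eq_bigl => h.
  by rewrite !inE; case: eqP => [->|]; rewrite ?Sw ?andbT ?andbF.
rewrite (partition_big (fun S : {set 'I_N} => inord #|S| : 'I_w.+1)
  (fun i => 0 < i)%N) /=; last first.
  by move=> S /andP[S0 Sw]; rewrite inordK.
rewrite big_add1 /= big_mkord big_mkcond big_ord_recl /= add0n.
apply: eq_bigr => i _.
transitivity (\sum_(S : {set 'I_N} | #|S| == i.+1) #|K0|.-1 ^ i.+1)%N; last first.
  by rewrite sum_nat_cond_const -[N in 'C(N, _)]card_ord -card_draws cardsE.
have cS (S : {set 'I_N}) :
    (0 < #|S| <= w)%N && (inord #|S| == lift ord0 i) = (#|S| == i.+1).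
  apply/andP/eqP => [[/andP[S0 Sw]]|->].
    by rewrite -val_eqE /= inordK // => /eqP->.
  by rewrite -val_eqE /= /bump /= add1n inordK ?ltnS ?ltn_ord.
by apply: eq_big => S; rewrite cS // => /eqP->.
Qed.

(** Nonzero scalars of [K0] act freely on the light vectors, and each orbit contains exactly one
    vector with [lead] equal to 1. *)
Lemma card_light_points (F : finFieldType) (K0 : divringClosed F) (N w : nat) :
  #|light K0 N w| = (#|K0|.-1 * #|points K0 N w|)%N.
Proof.
have -> : #|K0|.-1 = #|[set a in K0 | a != 0]|.
  rewrite [in LHS](cardD1 0) rpred0 /=; apply: eq_card => a.
  by rewrite !inE andbC.
rewrite -cardsX; symmetry.
rewrite -(@card_in_imset _ _ (fun p : F * {ffun 'I_N -> F} => scal p.1 p.2)).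
  apply: eq_card => h; apply/imsetP/idP.
    move=> [[a k] /setXP[/= /setIdP[aK a0] /setIdP[kl _]] ->].
    exact: scal_light.
  move=> hl; have [lK l0] := lead_in hl.
  exists (lead h, scal (lead h)^-1 h).
    by rewrite inE /= scal_lead_points // inE lK l0.
  by apply/ffunP=> i; rewrite !ffunE mulVKf.
move=> [a h] [b k] /setXP[/= + /setIdP[_ /eqP h1]] /setXP[/= + /setIdP[_ /eqP k1]].
rewrite !inE => /andP[_ a0] /andP[_ b0] e.
have ab : a = b.
  by rewrite -[a]mulr1 -h1 -lead_scal // e lead_scal // k1 mulr1.
congr (_, _) => //; apply/ffunP=> i; apply: (mulfI a0).
by have /ffunP/(_ i) := e; rewrite !ffunE ab.
Qed.

(** * Covering by exactly [rho] points, and the lower bound *)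

Lemma combination_of_points (F : finFieldType) (K0 : divringClosed F)
    (N w : nat) (x : 'rV[F]_N) (T : finType) (A : {set T})
    (u : T -> {ffun 'I_N -> F}) (c : T -> F) :
  (0 < #|A|)%N -> {in A, forall t, u t \in light K0 N w} ->
  {in A &, injective (fun t => supp (u t))} ->
  {in A, forall t, c t != 0} ->
  (forall i, x 0 i = \sum_(t in A) c t * u t i) ->
  exists (J : {set {h | h \in points K0 N w}})
         (d : {h | h \in points K0 N w} -> F),
    [/\ #|J| = #|A|, {in J, forall j, d j != 0}
      & x = \sum_(j in J) d j *: point_column j].
Proof.
move=> /card_gt0P[t0 t0A] ul u_inj c0 xE.
pose nu t := scal (lead (u t))^-1 (u t).
have l0 t : t \in A -> lead (u t) != 0 by move=> tA; case: (lead_in (ul t tA)).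
have nuP t : t \in A -> nu t \in points K0 N w.
  by move=> tA; apply/scal_lead_points/ul.
pose g0 : {h | h \in points K0 N w} := exist _ (nu t0) (nuP t0 t0A).
pose g t := insubd g0 (nu t).
have gE t : t \in A -> val (g t) = nu t by move=> tA; rewrite insubdK ?nuP.
(* Normalising preserves supports, so distinct supports give distinct points. *)
have g_inj : {in A &, injective g}.
  move=> s t sA tA /(congr1 val); rewrite !gE // => /(congr1 (@supp F N)).
  by rewrite !supp_scal ?invr_eq0 ?l0 // => /u_inj; apply.
(* By injectivity of [g] on [A] the sum has one term; the factor [lead (u t)] undoes the
   normalisation. *)
pose d j := \sum_(t in A | g t == j) c t * lead (u t).
have dE t : t \in A -> d (g t) = c t * lead (u t).
  move=> tA; rewrite /d (big_pred1 t) // => s; rewrite /=.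
  apply/andP/eqP => [[sA /eqP]|->]; [exact: g_inj | by rewrite tA eqxx].
exists (g @: A), d; split; first by rewrite card_in_imset.
  by move=> _ /imsetP[t tA ->]; rewrite dE // mulf_neq0 ?c0 ?l0.
rewrite big_imset //=; apply/rowP=> i; rewrite xE summxE; apply: eq_bigr => t tA.
by rewrite !mxE dE // gE // ffunE -mulrA mulVKf ?l0.
Qed.

Lemma card_divring_gt1 (F : finFieldType) (K0 : divringClosed F) :
  (1 < #|K0|)%N.
Proof. by rewrite (cardD1 0) (cardD1 1) !inE rpred0 rpred1 oner_neq0. Qed.

(* The K0-span of the entries of [x] has dimension at most [rho], so it is
   spanned by [rho] of these entries; expressing all entries by them yields
   vectors over K0 that vanish on all but one of the [rho] chosen positions. *)
Lemma heavy_cover (F : finFieldType) (K0 : divringClosed F) (N w rho : nat)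
    (x : 'rV[F]_N) :
  #|F| = (#|K0| ^ rho)%N -> (0 < rho)%N -> (N - rho < w)%N ->
  (rho <= #|[set i | x 0%R i != 0%R]|)%N ->
  exists (J : {set {h | h \in points K0 N w}})
         (d : {h | h \in points K0 N w} -> F),
    [/\ #|J| = rho, {in J, forall j, d j != 0}
      & x = \sum_(j in J) d j *: point_column j].
Proof.
move=> cF rho0 Nw; set S := [set i | _] => rhoS.
have K1 := card_divring_gt1 K0.
have [P0 [P0S ind span]] := exists_basis K0 S (x 0).
have cP0 : (#|P0| <= rho)%N.
  by have := card_independent ind; rewrite cF leq_exp2l.
(* The basis positions are enlarged to exactly [rho] positions within the support of [x], so that
   the coefficients [x 0 p] are nonzero. *)
have [|P [P0P PS cP]] := @exists_set_between _ P0 S rho P0S.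
  by rewrite cP0.
have /fin_all_exists2[a aK aE] : forall i, in_span K0 P (x 0) (x 0 i).
  move=> i; apply: (in_span_subset P0P); have [/span//|] := boolP (i \in S).
  rewrite inE negbK => /eqP->; exists (fun=> 0) => [t|]; first exact: rpred0.
  by rewrite big1 // => t _; rewrite mul0r.
pose u p := [ffun i => if i \in P then (i == p)%:R else a i p].
have uP p q : p \in P -> u q p = (p == q)%:R by move=> pP; rewrite ffunE pP.
rewrite -cP; apply: (@combination_of_points _ _ _ _ _ _ P u (x 0)).
- by rewrite cP.
- move=> p pP; rewrite inE; apply/andP; split.
    by apply/forallP=> i; rewrite ffunE; case: ifP; rewrite ?rpred_nat ?aK.
  apply/andP; split.
    by apply/card_gt0P; exists p; rewrite inE uP // eqxx oner_eq0.
  (* The support of [u p] lies in [p] and the [N - rho] positions outside [P], hence the weight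
     bound [N - rho + 1]. *)
  apply: (@leq_trans #|p |: ~: P|); last first.
    rewrite cardsU1 !inE pP /= cardsCs setCK cP card_ord.
    exact: Nw.
  apply/subset_leq_card/subsetP=> i; rewrite !inE ffunE.
  by case: ifP => // _; case: (i =P p) => // _; rewrite mulr0n eqxx.
- move=> p q pP qP /setP/(_ p); rewrite !inE !uP // eqxx oner_eq0.
  by case: (p =P q) => // _; rewrite mulr0n eqxx.
- by move=> p /(subsetP PS); rewrite inE.
move=> i; have [iP|iP] := boolP (i \in P).
  rewrite (bigD1 i) //= uP // eqxx mulr1 big1 ?addr0 // => p /andP[pP pi].
  by rewrite uP // eq_sym (negPf pi) mulr0.
by rewrite aE; apply: eq_bigr => p _; rewrite ffunE (negPf iP) mulrC.
Qed.

Lemma exists_avoiding (F : finType) (rho : nat) (s : 'I_rho -> F) :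
  (rho < #|F|)%N -> exists a : F, forall k, s k != a.
Proof.
move=> rhoF; have : (0 < #|~: [set s k | k : 'I_rho]|)%N.
  rewrite cardsCs setCK subn_gt0; apply: leq_ltn_trans rhoF.
  by rewrite -[X in (_ <= X)%N](card_ord rho) leq_imset_card.
case/card_gt0P=> a; rewrite inE => /imsetP aP; exists a => k.
by apply/eqP=> ka; apply: aP; exists k.
Qed.

(* List the support inside positions [s_1, .., s_(rho-1)] and put
   [e'_k = e_(s_k)] for [0 < k < rho] and [e'_0 = e'_rho = 0].  The [rho] vectors
   [e'_(k+1) - e'_k] form a circuit: the coefficients of [x] along them are
   determined by the partial sums of [x] up to one common additive constant. *)
Lemma sparse_cover (F : finFieldType) (K0 : divringClosed F) (N w rho : nat)
    (x : 'rV[F]_N) :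
  (rho < #|F|)%N -> (3 <= rho <= N)%N -> (2 <= w)%N ->
  (#|[set i | x 0%R i != 0%R]| < rho)%N ->
  exists (J : {set {h | h \in points K0 N w}})
         (d : {h | h \in points K0 N w} -> F),
    [/\ #|J| = rho, {in J, forall j, d j != 0}
      & x = \sum_(j in J) d j *: point_column j].
Proof.
move=> rhoF /andP[rho3 rhoN] w2; set S0 := [set i | _] => S0rho.
have [|S [S0S _ cS]] := @exists_set_between _ S0 setT rho.-1 (subsetT _).
  by rewrite cardsT card_ord; lia.
(* The default [rho.+1] differs from [k] and [k.+1] for every [k < rho], so all [u k] vanish outside
   [S]. *)
pose j (i : 'I_N) := if i \in S then (index i (enum S)).+1 else rho.+1.
have jS i : i \in S -> (0 < j i < rho)%N.
  move=> iS; rewrite /j iS /=; have : (index i (enum S) < size (enum S))%N.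
    by rewrite index_mem mem_enum.
  by rewrite -cardE cS -ltnS prednK // (ltn_trans _ rho3).
have jNS i : i \notin S -> j i = rho.+1 by rewrite /j => /negPf->.
have j_inj i i' : i \in S -> j i = j i' -> i = i'.
  move=> iS; have [i'S|i'S] := boolP (i' \in S); last first.
    by move=> e; have := jS i iS; rewrite e jNS //; lia.
  rewrite /j iS i'S => -[e].
  by rewrite -[LHS](@nth_index _ i _ (enum S)) ?mem_enum // e nth_index ?mem_enum.
have j_onto k : (0 < k < rho)%N -> exists2 i, i \in S & j i = k.
  case: k => // k krho; have kS : (k < size (enum S))%N by rewrite -cardE cS; lia.
  have i0 : 'I_N by apply: (@Ordinal _ 0); lia.
  exists (nth i0 (enum S) k); first by rewrite -mem_enum mem_nth.
  by rewrite /j -mem_enum mem_nth // index_uniq ?enum_uniq.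
pose u (k : 'I_rho) := [ffun i => (j i == k.+1)%:R - (j i == k)%:R : F].
have supp_u k i : (i \in supp (u k)) = (j i == k.+1) || (j i == k).
  rewrite inE ffunE; case: (j i =P k.+1) => [->|_].
    by rewrite (gtn_eqF (ltnSn k)) subr0 oner_eq0.
  by case: (j i =P k) => _; rewrite sub0r oppr_eq0 ?oner_eq0 ?eqxx.
pose sigma k := \sum_(i | (j i <= k)%N) x 0 i.
(* The free additive constant [a] is chosen off all [rho] partial sums, making every coefficient
   nonzero. *)
have [a aP] := @exists_avoiding F rho (fun k => sigma k) rhoF.
pose c k := a - sigma k.
have -> : rho = #|[set: 'I_rho]| by rewrite cardsT card_ord.
apply: (@combination_of_points _ _ _ _ _ _ _ u c).
- by rewrite cardsT card_ord; lia.
- move=> k _; rewrite inE; apply/andP; split.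
    by apply/forallP=> i; rewrite ffunE rpredB ?rpred_nat.
  apply/andP; split.
    have [|i _ ji] := j_onto (maxn 1 k); first by have := ltn_ord k; lia.
    by apply/card_gt0P; exists i; rewrite supp_u ji; lia.
  apply: leq_trans w2; apply: (@leq_trans (size [:: k.+1; k : nat])) => //.
  rewrite cardE -(size_map j); apply: uniq_leq_size.
    rewrite map_inj_in_uniq ?enum_uniq // => i i'; rewrite !mem_enum !supp_u.
    move=> ik _; apply: j_inj; apply: contraT => /jNS ji; move: ik; rewrite ji.
    by have := ltn_ord k; lia.
  by move=> _ /mapP[i + ->]; rewrite mem_enum supp_u !inE.
- move=> k l _ _ /setP e; apply/val_inj => /=; apply/eqP; apply: contraT => kl.
  have {}e i : ((j i == k.+1) || (j i == k)) = ((j i == l.+1) || (j i == l)).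
    by rewrite -!supp_u e.
  have := ltn_ord k; have := ltn_ord l => lr kr.
  have key m : (0 < m < rho)%N ->
      ((m == k.+1) || (m == k)) = ((m == l.+1) || (m == l)).
    by case/j_onto=> i _ <-.
  (* Positions 1, 2, [k] and [l] separate the supports. Position 2 is available since [rho] is at
     least 3; for [rho = 2] both supports would be the same singleton. *)
  have := key 1%N; have := key 2%N; have := key (val k); have := key (val l).
  by move=> /=; lia.
- by move=> k _; rewrite subr_eq0 eq_sym.
move=> i; have [iS|iS] := boolP (i \in S); last first.
  have -> : x 0 i = 0.
    by apply/eqP; apply: contraNT iS => xi; apply: (subsetP S0S); rewrite inE.
  rewrite big1 // => k _; rewrite ffunE jNS // eqSS.
  by rewrite (gtn_eqF (ltn_ord k)) (gtn_eqF (leqW (ltn_ord k))) subrr mulr0.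
have /andP[j0 jr] := jS i iS; have jr' := leq_ltn_trans (leq_pred _) jr.
(* Only [k = j i - 1] and [k = j i] contribute, leaving the difference of two consecutive partial
   sums, which is [x 0 i]. *)
under eq_bigr do rewrite ffunE mulrBr; rewrite sumrB.
rewrite (bigD1 (Ordinal jr')) ?inE //= prednK // eqxx mulr1 big1 ?addr0; last first.
  move=> k /andP[_]; rewrite -val_eqE /= => kj.
  suff -> : (j i == k.+1) = false by rewrite mulr0.
  by apply: contraNF kj => /eqP->.
rewrite (bigD1 (Ordinal jr)) ?inE //= eqxx mulr1 big1 ?addr0; last first.
  move=> k /andP[_]; rewrite -val_eqE /= => kj.
  by rewrite eq_sym (negPf kj) mulr0.
have sE : sigma (j i) = x 0 i + sigma (j i).-1.
  rewrite /sigma (bigD1 i) //=; congr (_ + _); apply: eq_bigl => i'.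
  rewrite -[RHS]ltnS prednK // ltn_neqAle andbC; congr (_ && _).
  by apply: negb_inj; rewrite !negbK; apply/eqP/eqP => [->|/esym/(j_inj _ _ iS)->].
by rewrite /c sE opprB addrC addrA subrK addrK.
Qed.

(** Take for the entries of [v] a [K0]-basis of [F], padded by zeros. As the columns have entries in
    [K0], any representation of [v] puts this basis in the [K0]-span of the coefficients [c t], so
    these span [F] and number at least [rho]. *)
Lemma basis_needs_columns (F : finFieldType) (K0 : divringClosed F)
    (N w rho : nat) :
  #|F| = (#|K0| ^ rho)%N -> (rho <= N)%N ->
  exists v : 'rV[F]_N, needs_columns (@point_column F K0 N w) rho v.
Proof.
move=> cF rhoN; have K1 := card_divring_gt1 K0.
have [P [_ ind span]] := exists_basis K0 setT (@id F).
have cP : #|P| = rho.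
  apply/eqP; rewrite -(eqn_exp2l _ _ K1) -cF eqn_leq (card_independent ind).
  by apply: (@card_le_span _ _ _ _ id) => y; apply: (span y); rewrite inE.
exists (\row_i nth 0 (enum P) i) => T A g c vE.
rewrite -(leq_exp2l _ _ K1) -cF; apply: (@card_le_span _ _ _ _ c) => y.
have [a aK ->] := span y (in_setT y).
have idx p : p \in P -> (index p (enum P) < N)%N.
  by move=> pP; apply: leq_trans rhoN; rewrite -cP cardE index_mem mem_enum.
pose b p t := if insub (index p (enum P)) is Some i then val (g t) i else 0.
have bK p t : b p t \in K0.
  rewrite /b; case: insubP => [i _ _|]; last by rewrite rpred0.
  by have := valP (g t); rewrite inE => /andP[]; rewrite inE => /andP[/forallP].
have pE p : p \in P -> p = \sum_(t in A) c t * b p t.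
  move=> pP; have := congr1 (fun v : 'rV[F]_N => v 0 (Ordinal (idx p pP))) vE.
  rewrite mxE nth_index ?mem_enum // => {1}->; rewrite summxE.
  by apply: eq_bigr => t _; rewrite !mxE /b (insubT (fun k => k < N)%N (idx p pP)).
exists (fun t => \sum_(p in P) a p * b p t) => [t|].
  by apply: rpred_sum => p _; rewrite rpredM.
under [RHS]eq_bigr do rewrite mulr_suml.
rewrite exchange_big /=; apply: eq_bigr => p pP.
rewrite [X in _ * X = _](pE p pP) mulr_sumr; apply: eq_bigr => t _.
by rewrite mulrCA mulrC.
Qed.

(** * The subfield and the resulting codes *)

Lemma frobenius_divring (F : finFieldType) (p k : nat) :
  p \in [pchar F] ->
  exists K0 : divringClosed F, K0 =i [pred x | x ^+ (p ^ k) == x].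
Proof.
move=> pF; have pnat : [pchar F].-nat (p ^ k)%N.
  by rewrite pnatX pnatE ?(pcharf_prime pF) ?pF.
(* Closure under subtraction holds because raising to the power [p ^ k] is additive in
   characteristic [p]. *)
have Kdiv : divring_closed [pred x : F | x ^+ (p ^ k) == x].
  split=> [|x y|x y]; rewrite !inE ?expr1n // => /eqP xE /eqP yE.
    apply/eqP/(addIr y); rewrite subrK -[X in _ + X = _]yE.
    by rewrite -exprDn_pchar // subrK.
  by rewrite expr_div_n xE yE.
pose K0 := HB.pack_for (divringClosed F) (fun x : F => x ^+ (p ^ k) == x)
  (GRing.isDivringClosed.Build F _ Kdiv).
by exists K0.
Qed.

(* Prescribing exactly [rho] nonzero coefficients is what makes the Vandermonde
   system of [concat_covers] solvable. *)
Lemma points_cover_exactly (F : finFieldType) (K0 : divringClosed F)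
    (N w rho : nat) :
  #|F| = (#|K0| ^ rho)%N -> (3 <= rho <= N)%N -> (2 <= w)%N -> (N - rho < w)%N ->
  covers_exactly (@point_column F K0 N w) rho.
Proof.
move=> cF /andP[rho3 rhoN] w2 Nw x.
have [heavy|sparse] := leqP rho #|[set i | x 0%R i != 0%R]|.
  by apply: heavy_cover => //; apply: leq_trans rho3.
apply: sparse_cover => //; last by rewrite rho3.
by rewrite cF ltn_expl // card_divring_gt1.
Qed.

Lemma exists_injection (I T : finType) :
  (#|I| <= #|T|)%N -> exists f : I -> T, injective f.
Proof.
move=> le; exists (fun i => enum_val (widen_ord le (enum_rank i))) => i j.
by move=> /enum_val_inj/(congr1 val)/= /val_inj/enum_rank_inj.
Qed.

(** Here [m] is the degree of [L] over [F]. For [m = 0] the base columns are used unchanged;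
    otherwise [L] has [#|F| ^ m] elements, enough for distinct [beta]. *)
Lemma points_code (F : finFieldType) (K0 : divringClosed F) (R gamma m : nat) :
  #|F| = (#|K0| ^ R)%N -> (3 <= R)%N -> (1 <= gamma)%N ->
  (m = 0 \/ #|points K0 (R + gamma) gamma.+1| <= #|F| ^ m)%N ->
  let n := (#|points K0 (R + gamma) gamma.+1| * #|F| ^ m)%N in
  let r := (R * m.+1 + gamma)%N in
  exists C : {vspace 'rV[F]_n},
    [/\ (r <= n)%N, \dim C = (n - r)%N & has_covering_radius r C R].
Proof.
move=> cF R3 gamma1 small n r.
have cov : covers_exactly (@point_column F K0 (R + gamma) gamma.+1) R.
  by apply: points_cover_exactly => //; [rewrite R3 leq_addr | rewrite addKn].
have [v vP] := basis_needs_columns gamma.+1 cF (leq_addr gamma R).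
have cI : #|{: {h | h \in points K0 (R + gamma) gamma.+1}}|
          = #|points K0 (R + gamma) gamma.+1| by rewrite card_sig.
have dimV : \dim {:'rV[F]_(R + gamma)} = (R + gamma)%N by rewrite dimvf /dim /= mul1n.
case: m => [|m] in small n r *.
  apply: (code_of_columns _ _ _ vP); rewrite ?dimV ?cI /r /n ?muln1 //.
  move=> x; have [J [c [cJ _ xE]]] := cov x.
  by exists J, c; rewrite cJ.
case: small => // small.
have [L dimL] := finField_extension F (ltn0Sn m).
have cL := card_finvect_type L; rewrite dimL in cL.
have le : (#|{: {h | h \in points K0 (R + gamma) gamma.+1}}| <= #|finvect_type L|)%N.
  by rewrite cI cL.
have [beta beta_inj] := exists_injection le.
apply: (code_of_columns _ _ (@concat_covers _ _ _ _ _ L beta beta_inj cov)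
  (@concat_needs_columns _ _ _ _ _ L beta _ vP)).
  by rewrite dim_concat dimV dimL /r; lia.
by rewrite card_prod cI cL.
Qed.

(* The length as a real number: asymptotics and integrality *)
From mathcomp Require Import all_classical all_reals all_analysis.
Import numFieldNormedType.Exports.

Local Open Scope classical_set_scope.
Local Open Scope ring_scope.

Lemma nRqE (K : realType) (R gamma m : nat) :
  (1 < m)%N ->
  nRq K R gamma m =
    \sum_(i < gamma.+1) (m%:R - 1) ^+ i * 'C(R + gamma, i.+1)%:R.
Proof.
move=> m1; have x0 : m%:R - 1 != 0 :> K by rewrite subr_eq0 pnatr_eq1 gtn_eqF.
rewrite /nRq big_add1 /= big_mkord mulr_suml; apply: eq_bigr => i _.
by rewrite mulrAC exprSr mulfK.
Qed.

Lemma powR_root_power (K : realType) (R gamma m : nat) :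
  (0 < R)%N -> (m ^ R)%:R `^ (gamma%:R / R%:R) = m%:R ^+ gamma :> K.
Proof.
move=> R0; rewrite natrX -powR_mulrn // -powRrM mulrCA mulfV ?mulr1 ?powR_mulrn //.
by rewrite pnatr_eq0 -lt0n.
Qed.

(* With x = m - 1, the leading term of [nRq] is x^gamma instead of m^gamma; both
   this change and the remaining terms are of order m^(gamma - 1). *)
Lemma nRq_error (K : realType) (R gamma m : nat) :
  (1 < m)%N -> (0 < gamma)%N ->
  `|nRq K R gamma m - 'C(R + gamma, gamma.+1)%:R * m%:R ^+ gamma|
    <= (\sum_(i < gamma) 'C(R + gamma, i.+1)%:R
        + 'C(R + gamma, gamma.+1)%:R * gamma%:R) * m%:R ^+ gamma.-1.
Proof.
move=> m1 gamma0; rewrite nRqE // big_ord_recr /=.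
set x : K := m%:R - 1; set y : K := m%:R.
have y1 : 1 <= y by rewrite ler1n ltnW.
have x0 : 0 <= x by rewrite subr_ge0.
have xy : x <= y by rewrite /x lerBlDr lerDl.
have y0 : 0 <= y by apply: le_trans xy.
set c := 'C(_, gamma.+1)%:R; set s := \sum_(i < gamma) _.
(* Since [y - x = 1], the difference of powers is a sum of [gamma] products, each at most
   [y ^+ gamma.-1]. *)
have diff : 0 <= y ^+ gamma - x ^+ gamma <= gamma%:R * y ^+ gamma.-1.
  rewrite subr_ge0 lerXn2r ?nnegrE //= subrXX.
  have -> : y - x = 1 by rewrite /x opprB addrC subrK.
  have -> : gamma%:R * y ^+ gamma.-1 = \sum_(i < gamma) y ^+ gamma.-1.
    by rewrite sumr_const card_ord mulr_natl.
  rewrite mul1r; apply: ler_sum => i _.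
  have -> : y ^+ gamma.-1 = y ^+ (gamma.-1 - i) * y ^+ i.
    by rewrite -exprD subnK // -ltnS prednK.
  by rewrite ler_wpM2l ?exprn_ge0 // lerXn2r ?nnegrE.
have sB : 0 <= s <= (\sum_(i < gamma) 'C(R + gamma, i.+1)%:R) * y ^+ gamma.-1.
  rewrite sumr_ge0 /= => [|i _]; last by rewrite mulr_ge0 ?exprn_ge0.
  rewrite mulr_suml; apply: ler_sum => i _; rewrite mulrC ler_wpM2l //.
  apply: (@le_trans _ _ (y ^+ i)); first by rewrite lerXn2r ?nnegrE.
  by rewrite ler_weXn2l // -ltnS prednK.
have c0 : 0 <= c by rewrite /c.
have := ler_wpM2l c0 (andP diff).2; have := mulr_ge0 c0 (andP diff).1.
case/andP: sB; rewrite mulrDl mulrBr mulrA => s0 s1 d0 d1.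
rewrite ler_norml; apply/andP; split; lra.
Qed.

Lemma nRq_equiv (K : realType) (R gamma : nat) :
  (0 < R)%N -> (0 < gamma)%N ->
  (fun m : nat => nRq K R gamma m)
    ~_(within prime_power \oo)
  (fun m : nat => 'C(R + gamma, R - 1)%:R
                    * (m ^ R)%:R `^ (gamma%:R / R%:R)).
Proof.
move=> R0 gamma0; apply/eqaddoP => _/posnumP[e].
have -> : 'C(R + gamma, R - 1) = 'C(R + gamma, gamma.+1).
  have -> : (R - 1 = R + gamma - gamma.+1)%N by lia.
  by rewrite bin_sub //; lia.
(* The estimate holds for all large [m], not only for prime powers. *)
apply: cvg_within; rewrite nbhs_filterE.
set c := 'C(R + gamma, gamma.+1)%:R.
pose A : K := \sum_(i < gamma) 'C(R + gamma, i.+1)%:R + c * gamma%:R.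
have c0 : 0 < c :> K by rewrite /c ltr0n bin_gt0; lia.
near=> m.
have m1 : (1 < m)%N by near: m; exists 2%N.
rewrite /= /GRing.add /GRing.opp /= powR_root_power //.
apply: (le_trans (nRq_error _ _ m1 gamma0)).
rewrite normrM normrX (ger0_norm (ltW c0)) normr_nat.
rewrite -[in leRHS](prednK gamma0) exprS !mulrA ler_wpM2r ?exprn_ge0 //.
rewrite -ler_pdivrMl ?mulr_gt0 //.
(* What remains is that [m] exceeds the constant [A] divided by the product of [e] and [c]. *)
near: m; exact: nbhs_infty_ger.
Unshelve. all: by end_near.
Qed.

(** Turns the double count of light vectors by [card_light] and [card_light_points] into the
    identification of [nRq] with the number of points. *)
Lemma nRq_card_points (K : realType) (R gamma m P : nat) :
  (1 < m)%N ->
  (\sum_(1 <= i < gamma.+2) 'C(R + gamma, i) * m.-1 ^ i = m.-1 * P)%N ->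
  nRq K R gamma m = P%:R.
Proof.
move=> m1 e; have x0 : m.-1%:R != 0 :> K by rewrite pnatr_eq0; case: m m1 e => [|[]].
have xE : m%:R - 1 = m.-1%:R :> K by rewrite -[in LHS](ltn_predK m1) -addn1 natrD addrK.
rewrite /nRq xE; apply: (mulIf x0); rewrite divfK // mulrC -natrM -e natr_sum.
by apply: eq_bigr => i _; rewrite natrM natrX mulrC.
Qed.

Theorem theorem23 (K : realType) (R gamma : nat)
    (hR : (4 <= R)%N) (hgamma : (2 <= gamma <= R - 1)%N) :
  ((fun m : nat => nRq K R gamma m)
     ~_(within prime_power \oo)
   (fun m : nat => 'C(R + gamma, R - 1)%:R
                     * (m ^ R)%:R `^ (gamma%:R / R%:R)))
  /\
  (forall (q' q : nat) (F : finFieldType) (t0 : int),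
     prime_power q' -> q = (q' ^ R)%N -> #|F| = q ->
     nRq K R gamma q' <= q%:R ^ (t0 - 1) ->
     forall r t : nat,
       r = (R * t + gamma)%N -> t = 1%N \/ t0 <= t%:Z ->
       exists (n w : nat) (C : {vspace 'rV[F]_n}),
         [/\ (w <= R - 3)%N,
             n%:R = nRq K R gamma q' * q%:R ^+ ((r - (R + gamma)) %/ R)
                    + w%:R * ((q%:R ^+ ((r - (R + gamma)) %/ R) - 1)
                              / (q%:R - 1)),
             (r <= n)%N,
             \dim C = (n - r)%N
           & has_covering_radius r C R]).
Proof.
have R0 : (0 < R)%N by lia.
have g0 : (0 < gamma)%N by lia.
split; first exact: nRq_equiv.
move=> q' q F t0 [p [k [pp k0 q'E]]] qE cF hq r t rE ht.
have q'1 : (1 < q')%N by rewrite q'E -(expn0 p) ltn_exp2l ?prime_gt1.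
have q1 : (1 < q)%N by rewrite -cF finNzRing_gt1.
have pF : p \in [pchar F].
  by apply: (@card_finPcharP _ _ (k * R)) => //; rewrite cF qE q'E expnM.
have [K0 K0E] := frobenius_divring k pF.
have cK0 : #|K0| = q'.
  by rewrite (eq_card K0E) -q'E (@card_frobenius_fixed _ _ R) // cF.
have cFK : #|F| = (#|K0| ^ R)%N by rewrite cK0 cF.
set P := #|points K0 (R + gamma) gamma.+1|.
have nE : nRq K R gamma q' = P%:R.
  by apply: nRq_card_points; rewrite // -cK0 -card_light_points card_light.
have R3 : (3 <= R)%N by lia.
(* The base code [m = 0] has length [P], which is at least its codimension [R + gamma]. *)
have P0 : (0 < P)%N.
  have [_ [+ _ _]] := points_code cFK R3 g0 (or_introl (erefl 0)).
  by rewrite expn0 muln1; apply: leq_trans; lia.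
have qK : 1 < q%:R :> K by rewrite ltr1n.
have tP : t0 <= t%:Z -> P%:R <= q%:R ^ (t%:Z - 1) :> K.
  rewrite -nE => tt0; apply: le_trans hq _.
  by apply: ler_weXz2l; [exact: ltW | rewrite lerD2r].
case: t => [|m] in rE ht tP *.
  (* The case [t = 0] is impossible: it would force [P] to be at most the inverse of [q]. *)
  case: ht => // /tP; rewrite sub0r leNgt => /negP[].
  apply: (@lt_le_trans _ _ 1); last by rewrite ler1n.
  by rewrite exprN1 invf_lt1 // ltr0n ltnW.
(* With [t = m.+1], the bound by [q ^ (t - 1)] becomes [P <= #|F| ^ m]. *)
have small : m = 0 \/ (P <= #|F| ^ m)%N.
  case: ht => [[->]|/tP Pq]; [by left | right; move: Pq].
  by rewrite intS addrAC subrr add0r -exprnP -natrX ler_nat cF.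
have [C [rn dimC covC]] := points_code cFK R3 g0 small.
exists (P * #|F| ^ m)%N, 0, C; rewrite rE.
have -> : ((R * m.+1 + gamma - (R + gamma)) %/ R = m)%N.
  by rewrite mulnS subnDr addKn mulKn.
by split=> //; rewrite mul0r addr0 nE natrM natrX cF.
Qed.
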